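(* Let $G$ be a discrete group, let $\mu\in\mathcal M(G)$ be a mean that vanishes on finite sets (i.e. $\mu(\chi_F)=0$ for every finite $F\subset G$), and let $x\in G\setminus\{e\}$. Then there exists a net $\langle S_\alpha\rangle$ in $\mathscr C^+$ such that $\mu_{S_\alpha}\to\mu$ in the $w^*$-topology, but $S_\alpha\cap xS_\alpha=\varnothing$ for all $\alpha$.
   Context: $G$ is a locally compact group with identity $e$, and $|E|$ denotes the left Haar measure of $E\subset G$ (here $G$ is discrete, so Haar measure is a multiple of counting measure). $\mathcal L_\infty(G)$ is the usual space with respect to Haar measure, identified with the dual of $\mathcal L_1(G)$. The set of means is $\mathcal M(G)=\{\mu\in\mathcal L_\infty^*(G): \|\mu\|=1,\ \mu\ge 0\}$, with the $w^*$-topology. Each $f\in\mathcal L_1(G)$ is regarded as an element of $\mathcal L_\infty^*(G)$ via $\phi\mapsto\int_G f\phi$. $\mathscr C^+$ is the set of compact subsets of $G$ with positive measure (for $G$ discrete: the nonempty finite subsets). For $A\in\mathscr C^+$, $\mu_A=\chi_A/|A|\in\mathcal L_1(G)$, regarded as a mean. *)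

(* Defs.v *)
From HB Require Import structures.
From mathcomp Require Import all_boot all_order all_algebra.
From mathcomp Require Import finmap.
From mathcomp Require Import all_classical all_reals all_analysis.
From mathcomp Require Import ess_sup_inf measurable_realfun.
Set Implicit Arguments.
Unset Strict Implicit.
Unset Printing Implicit Defensive.
Import Order.TTheory GRing.Theory Num.Theory.
Import numFieldNormedType.Exports.
Local Open Scope classical_set_scope.
Local Open Scope ring_scope.

Record directedType := DirectedType {
  directed_sort :> Type;
  directed_le : directed_sort -> directed_sort -> Prop;
  directed_inhabited : inhabited directed_sort;
  directed_refl : forall i, directed_le i i;
  directed_trans : forall i j k,
    directed_le i j -> directed_le j k -> directed_le i k;
  directed_ub : forall i j, exists2 k, directed_le i k & directed_le j k
}.

(* A net [u : I -> T] converges to [l] when [u @ net_filter I --> l]. *)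
Definition net_filter (I : directedType) : set_system I :=
  filter_from setT (fun i => [set j | directed_le i j]).

Arguments net_filter : clear implicits.

#[global] Instance net_filter_proper (I : directedType) :
  ProperFilter (net_filter I).
Proof.
have [i0] := directed_inhabited I.
apply: filter_from_proper; last by move=> i _; exists i; exact: directed_refl.
apply: filter_from_filter; first by exists i0.
move=> i j _ _; have [k ik jk] := directed_ub i j.
by exists k => // l kl; split; [exact: directed_trans ik kl|
  exact: directed_trans jk kl].
Qed.

Section dual.
Context {R : realType} (V : normedModType R).

Record dual := Dual {
  dual_fun :> {scalar V};
  dual_continuous : continuous (dual_fun : V -> R)
}.

Definition dual_norm (f : dual) : R :=
  sup [set `|f v| | v in [set v : V | `|v| <= 1]].

HB.instance Definition _ := gen_eqMixin dual.
HB.instance Definition _ := gen_choiceMixin dual.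

(* The topology put on [dual] is the w*-topology, not the norm topology. *)
HB.instance Definition _ := Topological.copy dual
  (initial_topology (fun f : dual => (f : {ptws V -> R}))).

Lemma dual_cvgP (F : set_system dual) (f : dual) : Filter F ->
  F --> f <-> forall v : V, h v @[h --> F] --> f v.
Proof.
move=> FF; pose i (h : dual) : {ptws V -> R} := h; split=> [Ff v|Ff].
  have : i @ F --> i f.
    by apply: cvg_trans (@initial_continuous _ _ i f); exact: cvg_app Ff.
  by move=> /(@pointwise_cvgP V R _ _ _)/(_ v).
have iF : i @ F --> i f by apply/(@pointwise_cvgP V R).
move=> A [_ [[C oC <-] Cf] CA].
have : F (i @^-1` C) by apply: iF; apply: open_nbhs_nbhs.
exact: filterS.
Qed.

End dual.

Definition discrete_group (G : groupType) : Type := G.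

HB.instance Definition _ (G : groupType) := Group.copy (discrete_group G) G.
HB.instance Definition _ (G : groupType) :=
  isPointed.Build (discrete_group G) 1%g.
HB.instance Definition _ (G : groupType) :=
  hasNbhs.Build (discrete_group G) principal_filter.
HB.instance Definition _ (G : groupType) :=
  Discrete_ofNbhs.Build (discrete_group G) erefl.
HB.instance Definition _ (G : groupType) :=
  @isMeasurable.Build default_measure_display (discrete_group G)
    discrete_measurable discrete_measurable0
    discrete_measurableC discrete_measurableU.

Section haar.
Context {R : realType} (G : groupType) (c : {posnum R}).

(* The Haar measures of a discrete group are the positive multiples of the
   counting measure; [c] is the mass of a point. *)
Definition haar : {measure set (discrete_group G) -> \bar R} :=
  mscale (c%:num)%:nng (@counting (discrete_group G) R).

Lemma haar_finite (A : set (discrete_group G)) : finite_set A ->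
  haar A = (c%:num * (#|` fset_set A|)%:R)%:E.
Proof. by move=> fA; rewrite /haar /= /mscale /= /counting asboolT. Qed.

Lemma haar_infinite (A : set (discrete_group G)) : ~ finite_set A ->
  haar A = +oo%E.
Proof.
by move=> iA; rewrite /haar /= /mscale /= /counting asboolF// gt0_muley ?lte_fin.
Qed.

Lemma haar_eq0 (A : set (discrete_group G)) : haar A = 0%E <-> A = set0.
Proof.
split=> [|->]; last exact: measure0.
have [fA|iA] := pselect (finite_set A); last by rewrite haar_infinite.
rewrite haar_finite// => -[] /eqP.
rewrite mulf_eq0 gt_eqF//= pnatr_eq0 cardfs_eq0 => /eqP A0.
by rewrite -(fset_setK fA) A0; apply/seteqP; split.
Qed.

Lemma haar_ae (P : set (discrete_group G)) :
  (\forall g \ae haar, P g) <-> forall g, P g.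
Proof.
split=> [[N [_ /haar_eq0 -> PN]] g|PT]; last exact: aeW.
by apply: contrapT => nPg; exact: (PN g).
Qed.

Lemma haar_setT_gt0 : (0 < haar setT)%E.
Proof.
rewrite lt0e measure_ge0 andbT; apply/eqP => /haar_eq0.
by move=> T0; have : [set: discrete_group G] 1%g by []; rewrite T0.
Qed.

Definition Lone := LfunType haar (lexx 1%E).
Definition Linfty := LfunType haar (leey 1%E).

HB.instance Definition _ := GRing.Lmodule.on Lone.
HB.instance Definition _ := GRing.Lmodule.on Linfty.

Definition Linfty_norm (phi : Linfty) : R :=
  fine ('N[haar]_+oo[EFin \o phi])%E.

Let Linfty_normD phi psi :
  Linfty_norm (phi + psi) <= Linfty_norm phi + Linfty_norm psi.
Proof. exact: ler_LnormD. Qed.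

Let Linfty_normZ (a : R) phi : Linfty_norm (a *: phi) = `|a| * Linfty_norm phi.
Proof.
apply: EFin_inj; rewrite EFinM !finite_norm_fine -LnormZ.
exact: eq_Lnorm.
Qed.

(* The only null set of a discrete group is the empty set, so no quotient is
   needed for the essential supremum to be a norm. *)
Let Linfty_norm0_eq0 phi : Linfty_norm phi = 0 -> phi = 0.
Proof.
move=> /fine_Lnormr_eq0 /haar_ae phi0.
by apply/LfuneqP => g; exact: phi0.
Qed.

HB.instance Definition _ := Lmodule_isNormed.Build R Linfty
  Linfty_normD Linfty_normZ Linfty_norm0_eq0.

Lemma Linfty_norm_ge (phi : Linfty) g : `|phi g| <= `|phi|.
Proof.
rewrite -lee_fin [leRHS]finite_norm_fine unlock /= haar_setT_gt0.
move: g; apply/haar_ae; exact: ess_sup_ge.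
Qed.

Lemma indic_Linfty_subproof (A : set (discrete_group G)) :
  (\1_A : discrete_group G -> R) \in Lfun haar +oo%E.
Proof.
rewrite inE; apply/andP; split; rewrite inE//=.
rewrite /finite_norm unlock haar_setT_gt0; apply: (@le_lt_trans _ _ 1%E).
  apply/ess_supP; apply: aeW => g /=.
  by rewrite lee_fin indicE; case: (_ \in _); rewrite ?normr1 ?normr0.
exact: ltry.
Qed.

Definition indic_Linfty (A : set (discrete_group G)) : Linfty :=
  Lfun_Sub (leey 1%E) (indic_Linfty_subproof A).

Lemma Lone_Linfty_integrable (f : Lone) (phi : Linfty) :
  haar.-integrable setT (EFin \o (fun g => f g * phi g)).
Proof.
have fi : haar.-integrable setT (EFin \o f).
  by apply/Lfun1_integrable; exact: LfunP.
apply: (@integrableMl _ _ _ _ _ measurableT _ phi fi) => //.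
exists `|phi|; split; first exact: num_real.
by move=> M phiM g _; apply: le_trans (Linfty_norm_ge phi g) (ltW phiM).
Qed.

Section Lone_dual.
Variable f : Lone.

Definition Lone_dual_fun (phi : Linfty) : R := \int[haar]_g (f g * phi g).

Let Lone_dual_fun_linear : scalar Lone_dual_fun.
Proof.
move=> a phi psi; rewrite /Lone_dual_fun.
rewrite -RintegralZl//; last exact: Lone_Linfty_integrable.
rewrite -RintegralD//.
- by apply: eq_Rintegral => g _ /=; rewrite mulrDr mulrCA.
- have /(integrableZl measurableT a) := Lone_Linfty_integrable f phi.
  by apply: eq_integrable => // g _ /=; rewrite EFinM.
- exact: Lone_Linfty_integrable.
Qed.

HB.instance Definition _ :=
  GRing.isLinear.Build R Linfty R *%R Lone_dual_fun Lone_dual_fun_linear.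

Let Lone_dual_fun_continuous : continuous Lone_dual_fun.
Proof.
pose F : {linear Linfty -> R^o} := HB.pack Lone_dual_fun
  (GRing.isLinear.Build R Linfty R^o *:%R Lone_dual_fun Lone_dual_fun_linear).
have fi : haar.-integrable setT (EFin \o f).
  by apply/Lfun1_integrable; exact: LfunP.
have fni : haar.-integrable setT (EFin \o (Num.norm \o f)).
  by have := integrable_norm fi.
apply: (@bounded_linear_continuous _ _ _ F).
apply/linear_boundedP; exists (\int[haar]_g `|f g|); split.
  exact: num_real.
move=> M fM phi /=.
apply: (@le_trans _ _ (\int[haar]_g (`|f g| * `|phi|))).
  apply: le_trans (le_normr_Rintegral _ (Lone_Linfty_integrable f phi)) _ => //.
  apply: le_Rintegral => //.
  - by have := integrable_norm (Lone_Linfty_integrable f phi).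
  - have := integrableZr measurableT `|phi| fni.
    by apply: eq_integrable => // g _ /=; rewrite EFinM.
  - by move=> g _; rewrite normrM ler_wpM2l// Linfty_norm_ge.
by rewrite RintegralZr// ler_wpM2r// ltW.
Qed.

Definition Lone_dual : dual Linfty := Dual Lone_dual_fun_continuous.

End Lone_dual.

Definition means : set (dual Linfty) := [set mu : dual Linfty |
  dual_norm mu = 1 /\
  forall phi : Linfty, (forall g, 0 <= phi g) -> 0 <= mu phi].

Record Cplus := {
  Cplus_set :> set (discrete_group G);
  Cplus_compact : compact Cplus_set;
  Cplus_gt0 : (0 < haar Cplus_set)%E
}.

Lemma compact_haar_gt0P (A : set (discrete_group G)) :
  compact A /\ (0 < haar A)%E <-> finite_set A /\ A !=set0.
Proof.
have -> : (0 < haar A)%E <-> A !=set0.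
  rewrite lt0e measure_ge0 andbT; split=> [/eqP A0|].
    by apply/set0P/eqP => /haar_eq0.
  by move=> /set0P/eqP A0; apply/eqP => /haar_eq0.
split=> -[cA A0]; split => //; last exact: finite_compact.
have := cA; rewrite compact_cover.
move=> /(_ (discrete_group G) A (fun x => [set x])) [].
- by move=> x _; exact: discrete_open.
- by move=> x Ax; exists x.
move=> D _ AD; apply: sub_finite_set AD _.
by apply: bigcup_finite => [|x _]; [exact: finite_fset|exact: finite_set1].
Qed.

Lemma normalized_indic_subproof (A : Cplus) :
  (fun g : discrete_group G => \1_A g / fine (haar A)) \in Lfun haar 1%E.
Proof.
have [fA _] := (compact_haar_gt0P A).1 (conj (@Cplus_compact A) (Cplus_gt0 A)).
apply/Lfun1_integrable.
have : haar.-integrable setT (EFin \o (\1_A : discrete_group G -> R)).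
  apply/integrableP; split; first exact/measurable_EFinP.
  under eq_integral => g _ do rewrite gee0_abs ?lee_fin//.
  by rewrite integral_indic// setIT haar_finite// ltry.
move=> /(integrableZr measurableT (fine (haar A))^-1).
by apply: eq_integrable => // g _ /=; rewrite EFinM.
Qed.

Definition normalized_indic (A : Cplus) : Lone :=
  Lfun_Sub (lexx 1%E) (normalized_indic_subproof A).

Definition mean_of (A : Cplus) : dual Linfty :=
  Lone_dual (normalized_indic A).

End haar.

(* Main.v *)
Require Import Defs.
From mathcomp Require Import all_boot all_order all_algebra.
From mathcomp Require Import finmap.
From mathcomp Require Import all_classical all_reals all_analysis.
From mathcomp Require Import ess_sup_inf measurable_realfun.
From mathcomp Require Import lra.
Import Order.TTheory GRing.Theory Num.Theory.
Import numFieldNormedType.Exports.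
Local Open Scope classical_set_scope.
Local Open Scope ring_scope.

(** A w*-neighbourhood of [mu] only tests finitely many bounded functions up to
    some [e], so it is enough to find, for each such test, a single finite [S]
    disjoint from [x S] whose uniform average passes it; the sets [S] then form
    a net indexed by the tests.

    Bounded functions are almost step functions: there is a map [q] from the
    group to a finite type such that every tested function varies by at most
    [e] on each cell [q^-1 t].  Two positive unital functionals that nearly
    agree on the indicators of the cells therefore nearly agree on the tested
    functions ([positive_dist_cell]), and only the weights [w t = mu(1_cell t)]
    matter.  These weights are nonnegative with sum 1, so they are
    approximated by the frequencies in some finite word [l] over the cells that
    never uses a cell of weight 0 ([exists_empirical_approx]).

    Since [mu] vanishes on finite sets, the cells occurring in [l] are all
    infinite.  Hence [l] lifts to a sequence of distinct group elements with a
    lot of freedom: each new element may be chosen outside any given finite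
    set, in particular outside [S], [x S] and [x^-1 S], where [S] collects the
    elements already chosen ([exists_translate_free_seq]).  The condition
    [x <> 1] says that the new element is not its own translate.  The resulting
    set is disjoint from its translate and meets each cell in exactly the
    prescribed proportion. *)

(** * Combinatorics of finite words *)

(** Round each [N * w t] down to an integer.  The length of the word then lies
    between [N - #|T|] and [N], so every frequency is off by at most
    [#|T| / (N - #|T|)]; rounding down also keeps zero weights at zero. *)
Lemma exists_empirical_approx (R : realType) (T : finType) (w : T -> R)
    (d : R) : 0 < d -> (forall t, 0 <= w t) -> \sum_t w t = 1 ->
  exists l : seq T, [/\ (0 < size l)%N, forall t, w t = 0 -> t \notin l &
    forall t, `|(count_mem t l)%:R / (size l)%:R - w t| <= d].
Proof.
move=> d0 w0 w1; pose m : R := #|T|%:R.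
have m0 : 0 <= m by exact: ler0n.
(* This size of [N] makes [m / (N - m)] at most [d]. *)
pose N := (Num.truncn (m + m / d)).+1.
have Nm : m + m / d < N%:R by exact: truncnS_gt.
pose k t := Num.truncn (N%:R * w t).
have kP t : (k t)%:R <= N%:R * w t < (k t)%:R + 1.
  by rewrite natr1; apply: truncn_itv; rewrite mulr_ge0.
pose l := flatten [seq nseq (k t) t | t <- enum T].
have cl t : count_mem t l = k t.
  rewrite count_flatten -map_comp sumnE big_map big_enum/= (bigD1 t)//=.
  rewrite count_nseq/= eqxx mul1n big1 ?addn0// => u /negbTE ut.
  by rewrite count_nseq/= ut.
have sl : (size l)%:R = \sum_t (k t)%:R :> R.
  rewrite size_flatten sumnE /shape -map_comp big_map big_enum/= natr_sum.
  by apply: eq_bigr => t _; rewrite /= size_nseq.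
have NE : N%:R = \sum_t N%:R * w t by rewrite -mulr_sumr w1 mulr1.
have lN : (size l)%:R <= N%:R :> R.
  rewrite sl NE; apply: ler_sum => t _.
  by case/andP: (kP t).
have Nl : N%:R <= (size l)%:R + m.
  rewrite sl NE /m -sum1_card natr_sum -big_split/=.
  by apply: ler_sum => t _; have /andP[_ /ltW] := kP t.
have md0 : 0 <= m / d by rewrite divr_ge0// ltW.
have l0 : 0 < (size l)%:R :> R by lra.
exists l; split; first by rewrite -(ltr0n R).
  move=> t wt; rewrite -has_pred1 has_count cl -leqNgt.
  by rewrite /k wt mulr0 truncn0.
move=> t; rewrite cl.
have w1t : w t <= 1.
  by rewrite -w1 (bigD1 t)//= lerDl sumr_ge0.
have m1 : 1 <= m by rewrite ler1n; apply/card_gt0P; exists t.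
have -> : (k t)%:R / (size l)%:R - w t =
    ((k t)%:R - (size l)%:R * w t) / (size l)%:R.
  by rewrite mulrBl mulrAC mulfV ?mul1r// gt_eqF.
rewrite normrM [X in _ * X]gtr0_norm ?invr_gt0// ler_pdivrMr//.
apply: (@le_trans _ _ m); last first.
  by rewrite mulrC -ler_pdivrMr//; lra.
have /andP[k1 k2] := kP t; have := w0 t => wt0.
have h1 : (N%:R - (size l)%:R) * w t <= m * 1 by apply: ler_pM; lra.
have h2 : 0 <= (N%:R - (size l)%:R) * w t by apply: mulr_ge0; lra.
by rewrite ler_norml; apply/andP; split; lra.
Qed.

(** Greedy choice: adding [g] to a translate-free sequence [s] can only fail
    when [g] lies in the finite set made of [s], [x s] and [x^-1 s], which does
    not exhaust an infinite fibre. *)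
Lemma exists_translate_free_seq (G : groupType) (T : eqType) (q : G -> T)
    (x : G) (l : seq T) : x <> 1%g ->
  (forall t, t \in l -> infinite_set (q @^-1` [set t])) ->
  exists s : seq G, [/\ uniq s, map q s = l &
    forall g h, g \in s -> h \in s -> g <> (x * h)%g].
Proof.
move=> x1; elim: l => [|t l IH] linf; first by exists [::].
have [u|s [us qs sx]] := IH.
  by move=> ul; apply: linf; rewrite inE ul orbT.
pose bad := s ++ [seq (x * h)%g | h <- s] ++ [seq (x^-1 * h)%g | h <- s].
have tinf : infinite_set (q @^-1` [set t]) by apply: linf; rewrite mem_head.
have [g [/= qg /negP]] := infinite_setN0 (infinite_setD tinf (finite_seq bad)).
rewrite !mem_cat !negb_or => /and3P[gs gxs gxVs].
exists (g :: s); split; first by rewrite /= gs.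
  by rewrite /= qg qs.
move=> a b; rewrite !inE => /orP[/eqP->|sa] /orP[/eqP->|sb].
- by move/eqP; rewrite -{1}(mul1g g) (inj_eq (mulIg _)) eq_sym => /eqP.
- by move=> gE; move: gxs; rewrite gE (map_f (fun h => x * h)%g).
- move=> aE; move: gxVs; have -> : g = (x^-1 * a)%g by rewrite aE mulKg.
  by rewrite (map_f (fun h => x^-1 * h)%g).
- exact: sx.
Qed.

(** * Partitions on which bounded functions oscillate little *)

(** The cells are the preimages of the intervals of length [e] that cover
    [[-B, B]]. *)
Lemma exists_small_oscillation1 (R : realType) (X : Type) (B e : R)
    (f : X -> R) : 0 < e -> (forall g, `|f g| <= B) ->
  exists (n : nat) (q : X -> 'I_n.+1),
    forall g h, q g = q h -> `|f g - f h| <= e.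
Proof.
move=> e0 fB; pose k g := Num.truncn ((f g + B) / e).
have pos g : 0 <= (f g + B) / e.
  rewrite divr_ge0// ?(ltW e0)//; have := fB g; rewrite ler_norml => /andP[].
  by lra.
have kle g : (k g < (Num.truncn ((B + B) / e)).+1)%N.
  rewrite ltnS; apply: le_truncn; rewrite ler_pM2r ?invr_gt0// lerD2r.
  by rewrite (le_trans (ler_norm _)).
exists (Num.truncn ((B + B) / e)), (fun g => Ordinal (kle g)) => g h [kgh].
have /andP[g1 g2] := truncn_itv (pos g).
have /andP[h1 h2] := truncn_itv (pos h).
move: g1 g2 h1 h2; rewrite -!/(k _) kgh -natr1 => g1 g2 h1 h2.
have -> : f g - f h = ((f g + B) / e - (f h + B) / e) * e.
  by rewrite -mulrBl mulfVK ?gt_eqF//; lra.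
rewrite normrM (gtr0_norm e0) ler_piMl ?(ltW e0)// ler_norml.
by apply/andP; split; lra.
Qed.

Lemma exists_small_oscillation (R : realType) (X : Type) (I : eqType) (e : R)
    (f : I -> X -> R) (s : seq I) : 0 < e ->
  (forall i, exists B : R, forall g, `|f i g| <= B) ->
  exists (T : finType) (q : X -> T), forall i, i \in s ->
    forall g h, q g = q h -> `|f i g - f i h| <= e.
Proof.
move=> e0 bd; elim: s => [|i s [T [q qP]]]; first by exists unit, (fun=> tt).
have [B fB] := bd i.
have [n [r rP]] := exists_small_oscillation1 _ _ _ _ _ e0 fB.
exists ('I_n.+1 * T)%type, (fun g => (r g, q g)) => j.
rewrite inE => /predU1P[->|js] g h [rgh qgh]; first exact: rP.
exact: qP.
Qed.

(** * Positive unital functionals *)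

Section functional.
Context {R : realType} {G : groupType} {c : {posnum R}}.
Local Notation Linf := (Linfty G c).
Local Notation one := (@indic_Linfty R G c setT).

(** On bounded functions this is the same as being a mean, but it is directly
    checked for averages and does not mention the dual norm. *)
Definition positive_unital (nu : dual Linf) :=
  (forall phi : Linf, (forall g, 0 <= phi g) -> 0 <= nu phi) /\ nu one = 1.

Lemma oneE g : one g = 1.
Proof. by rewrite /= indicT. Qed.

Lemma norm_one_le1 : `|one : Linf| <= 1.
Proof.
rewrite -lee_fin [leLHS]finite_norm_fine unlock /= haar_setT_gt0.
apply/ess_supP; apply: aeW => g /=.
by rewrite indicT normr1.
Qed.

Lemma dualD (nu : dual Linf) (phi psi : Linf) :
  nu (phi + psi) = nu phi + nu psi.
Proof. exact: linearD. Qed.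

Lemma dualB (nu : dual Linf) (phi psi : Linf) :
  nu (phi - psi) = nu phi - nu psi.
Proof. exact: linearB. Qed.

Lemma dualZ (nu : dual Linf) (a : R) (phi : Linf) : nu (a *: phi) = a * nu phi.
Proof. exact: linearZ. Qed.

(** Apply positivity to [e - (phi - psi)] and [e + (phi - psi)]. *)
Lemma positive_dist (nu : dual Linf) (phi psi : Linf) (e : R) :
  positive_unital nu -> (forall g, `|phi g - psi g| <= e) ->
  `|nu phi - nu psi| <= e.
Proof.
move=> [nu0 nu1] h.
have bd g : - e <= phi g - psi g <= e by rewrite -ler_norml.
have h1 : 0 <= nu (e *: one + (phi - psi)).
  apply: nu0 => g; have /andP[+ _] := bd g.
  rewrite (_ : (e *: one + (phi - psi)) g = e * one g + (phi g - psi g))//.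
  by rewrite oneE; lra.
have h2 : 0 <= nu (e *: one - (phi - psi)).
  apply: nu0 => g; have /andP[_ +] := bd g.
  rewrite (_ : (e *: one - (phi - psi)) g = e * one g - (phi g - psi g))//.
  by rewrite oneE; lra.
move: h1 h2; rewrite dualD !dualB dualZ nu1 mulr1.
by move=> h1 h2; rewrite ler_norml; apply/andP; split; lra.
Qed.

(** Positivity alone forces [|nu v| <= nu 1] on the unit ball, which contains
    the constant 1; hence the dual norm of [nu] is [nu 1]. *)
Lemma means_positive_unital (nu : dual Linf) : means nu -> positive_unital nu.
Proof.
move=> [nu1 nu0]; split=> //.
have one0 : 0 <= nu one by apply: nu0 => g; rewrite oneE.
have ub (v : Linf) : `|v| <= 1 -> `|nu v| <= nu one.
  move=> v1; have bd g : -1 <= v g <= 1.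
    by rewrite -ler_norml (le_trans (Linfty_norm_ge v g)).
  have h1 : 0 <= nu (one - v).
    apply: nu0 => g; have /andP[_ +] := bd g.
    by rewrite (_ : (one - v) g = one g - v g)// oneE; lra.
  have h2 : 0 <= nu (one + v).
    apply: nu0 => g; have /andP[+ _] := bd g.
    by rewrite (_ : (one + v) g = one g + v g)// oneE; lra.
  move: h1 h2; rewrite dualB dualD => h1 h2.
  by rewrite ler_norml; apply/andP; split; lra.
apply/eqP; rewrite -nu1 eq_le; apply/andP; split.
  rewrite -[leLHS]ger0_norm//; apply: ub_le_sup.
    by exists (nu one) => _ [v /= v1 <-]; exact: ub.
  by exists one => //=; exact: norm_one_le1.
apply: ge_sup; first by exists `|nu one|, one => //=; exact: norm_one_le1.
by move=> _ [v /= v1 <-]; exact: ub.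
Qed.

Lemma Cplus_finite (A : Cplus G c) : finite_set A.
Proof.
have [] // := (compact_haar_gt0P c A).1.
by split; [exact: Cplus_compact|exact: Cplus_gt0].
Qed.

Lemma mean_of_indic (A : Cplus G c) (E : set (discrete_group G)) :
  mean_of A (indic_Linfty c E) = fine (haar G c (A `&` E)) / fine (haar G c A).
Proof.
rewrite -[LHS]/(\int[haar G c]_g (\1_A g / fine (haar G c A) * \1_E g)).
under eq_Rintegral => g _.
  rewrite (_ : _ * _ = \1_(A `&` E) g * (fine (haar G c A))^-1); last first.
    by rewrite indicI/= mulrAC.
  over.
rewrite RintegralZr//.
  by rewrite /Rintegral integral_indic// setIT.
apply/integrableP; split; first exact/measurable_EFinP.
under eq_integral => g _ do rewrite gee0_abs ?lee_fin//.
rewrite integral_indic// setIT haar_finite ?ltry//.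
exact: finite_setIl (Cplus_finite A).
Qed.

Lemma haar_seq (s : seq (discrete_group G)) : uniq s ->
  haar G c [set` s] = (c%:num * (size s)%:R)%:E.
Proof.
move=> us; rewrite haar_finite; last exact: finite_seq.
rewrite (_ : [set` s] = [set` [fset x in s]%fset]).
  by rewrite set_fsetK card_fseq undup_id.
by apply/seteqP; split=> g /=; rewrite inE.
Qed.

Lemma mean_of_positive_unital (A : Cplus G c) : positive_unital (mean_of A).
Proof.
split=> [phi phi0|].
  apply: Rintegral_ge0 => g _; rewrite mulr_ge0//= divr_ge0//.
  by rewrite fine_ge0.
rewrite mean_of_indic setIT divff// fine_eq0//.
  by rewrite gt_eqF// Cplus_gt0.
by rewrite haar_finite//; exact: Cplus_finite.
Qed.

Section partition.
Variables (T : finType) (q : discrete_group G -> T).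
Let cell t := indic_Linfty c (q @^-1` [set t]).

Lemma step_functionE (a : T -> R) g :
  (\sum_t a t *: cell t : Linf) g = a (q g).
Proof.
transitivity (\sum_t a t * cell t g).
  exact: (big_morph (fun f : Linf => f g) (fun _ _ => erefl) erefl).
rewrite (bigD1 (q g))//= big1 ?addr0.
  by rewrite indicE mem_set//= mulr1.
move=> t /eqP tq; rewrite indicE memNset ?mulr0//=.
by move=> qt; apply: tq.
Qed.

Lemma dual_step_function (nu : dual Linf) (a : T -> R) :
  nu (\sum_t a t *: cell t) = \sum_t a t * nu (cell t).
Proof. by rewrite linear_sum; apply: eq_bigr => t _; rewrite linearZ. Qed.

Lemma sum_cell (nu : dual Linf) : positive_unital nu ->
  \sum_t nu (cell t) = 1.
Proof.
move=> [_ <-]; transitivity (\sum_t 1 * nu (cell t)).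
  by apply: eq_bigr => t _; rewrite mul1r.
rewrite -(dual_step_function nu (fun=> 1)); congr (nu _).
by apply/LfuneqP => g; rewrite step_functionE oneE.
Qed.

(** Freeze [phi] at one sample point of each cell.  The resulting step function
    [psi] is within [e] of [phi], which costs [e] for each functional, and on
    [psi] the functionals differ by at most [d * |phi|] per cell. *)
Lemma positive_dist_cell (mu nu : dual Linf) (phi : Linf) (e d : R) :
  positive_unital mu -> positive_unital nu ->
  (forall g h, q g = q h -> `|phi g - phi h| <= e) ->
  (forall t, `|nu (cell t) - mu (cell t)| <= d) ->
  `|nu phi - mu phi| <= 2 * e + #|T|%:R * (`|phi| * d).
Proof.
move=> pmu pnu osc cd.
(* The default value of [xget] only serves empty cells. *)
pose a t := phi (xget 1%g (q @^-1` [set t])).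
pose psi : Linf := \sum_t a t *: cell t.
have ppsi g : `|phi g - psi g| <= e.
  rewrite step_functionE; apply: osc.
  by rewrite (xgetPex _ (P := q @^-1` [set q g]))//; exists g.
have h1 := positive_dist _ _ _ _ pmu ppsi.
have h2 := positive_dist _ _ _ _ pnu ppsi.
have h3 : `|nu psi - mu psi| <= #|T|%:R * (`|phi| * d).
  rewrite !dual_step_function -sumrB.
  apply: (le_trans (ler_norm_sum _ _ _)).
  rewrite -sum1_card natr_sum mulr_suml; apply: ler_sum => t _.
  by rewrite mul1r -mulrBr normrM ler_pM// Linfty_norm_ge.
move: h1 h2 h3; rewrite !ler_norml => /andP[? ?] /andP[? ?] /andP[? ?].
by apply/andP; split; lra.
Qed.

End partition.

(** * Approximation by averages over translate-free sets *)

(** One translate-free finite set passes any prescribed finite test: half of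
    the error [e] is spent on the oscillation over the cells, and a quarter on
    the frequencies of the cells. *)
Lemma exists_translate_free_mean (mu : dual Linf) (x : discrete_group G)
    (s : seq Linf) (e : R) : means mu ->
  (forall F : set (discrete_group G), finite_set F ->
    mu (indic_Linfty c F) = 0) ->
  x <> 1%g -> 0 < e ->
  exists S : Cplus G c, S `&` [set (x * g)%g | g in S] = set0 /\
    forall phi, phi \in s -> `|mean_of S phi - mu phi| <= e.
Proof.
move=> /means_positive_unital pmu mufin x1 e0.
have e4 : 0 < e / 4 by rewrite divr_gt0.
have bd (phi : Linf) : exists B, forall g, `|phi g| <= B.
  by exists `|phi|; exact: Linfty_norm_ge.
have [T [q osc]] := exists_small_oscillation _ _ _ _ _ s e4 bd.
pose cell t := indic_Linfty c (q @^-1` [set t]).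
(* A common bound for the tested functions, kept away from 0 to divide by it. *)
pose B : R := 1 + \sum_(phi <- s) `|phi|.
have B1 : 1 <= B by rewrite lerDl sumr_ge0.
have Bge phi : phi \in s -> `|phi| <= B.
  move=> ps; rewrite /B (big_rem phi)//= addrCA lerDl.
  by rewrite addr_ge0// sumr_ge0.
have T1 : 1 <= #|T|%:R :> R by rewrite ler1n; apply/card_gt0P; exists (q 1%g).
pose d := e / 4 / (#|T|%:R * B).
have TB0 : 0 < #|T|%:R * B by apply: mulr_gt0; lra.
have d0 : 0 < d by rewrite divr_gt0.
have w0 t : 0 <= mu (cell t) by apply: pmu.1 => g /=; rewrite indicE.
have [l [l0 wl ld]] :=
  exists_empirical_approx _ _ _ _ d0 w0 (sum_cell _ q _ pmu).
(* A finite cell has weight 0 because [mu] vanishes on finite sets. *)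
have linf t : t \in l -> infinite_set (q @^-1` [set t]).
  by move=> tl ft; move: (wl t (mufin _ ft)); rewrite tl.
have [sg [usg qsg fsg]] := exists_translate_free_seq _ _ _ _ _ x1 linf.
have ssg : size sg = size l by rewrite -qsg size_map.
have : finite_set [set` sg] /\ [set` sg] !=set0.
  split; first exact: finite_seq.
  by case: (sg) ssg l0 => [/= <-//|g ? _ _]; exists g; rewrite /= mem_head.
move=> /(compact_haar_gt0P c)[cS S0].
pose S := Build_Cplus cS S0.
exists S; split.
  by apply/seteqP; split=> // g [gs [h hs hg]]; exact: (fsg g h gs hs).
have cellE t : mean_of S (cell t) = (count_mem t l)%:R / (size l)%:R.
  rewrite mean_of_indic /= (_ : _ `&` _ = [set` [seq g <- sg | q g == t]]).
    rewrite !haar_seq ?filter_uniq//= -mulf_div divff ?gt_eqF// mul1r.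
    by rewrite size_filter ssg -qsg count_map.
  apply/seteqP; split=> g /=; rewrite mem_filter.
    by move=> [-> /eqP ->].
  by move=> /andP[/eqP -> ->].
move=> phi ps.
have dl t : `|mean_of S (cell t) - mu (cell t)| <= d by rewrite cellE.
apply: (le_trans (positive_dist_cell _ _ _ _ _ _ _ pmu
  (mean_of_positive_unital S) (osc _ ps) dl)).
have : #|T|%:R * (`|phi| * d) <= #|T|%:R * B * d.
  by rewrite -mulrA ler_wpM2l// ler_wpM2r ?Bge// ltW.
have -> : #|T|%:R * B * d = e / 4 by rewrite mulrC mulfVK// gt_eqF.
lra.
Qed.

End functional.

(** The index set of the net: a finite list of test vectors together with a
    precision [n], read as the tolerance [1 / (n + 1)].  The structure is
    transparent because its elements are used as pairs. *)
Definition finite_tests (V : eqType) : directedType.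
Proof.
apply: (@DirectedType (seq V * nat)
  (fun i j => {subset i.1 <= j.1} /\ (i.2 <= j.2)%N)).
- by split; exact: ([::], 0%N).
- by move=> i; split.
- by move=> i j k [ij1 ij2] [jk1 jk2]; split; [move=> v /ij1/jk1|
    exact: leq_trans jk2].
- move=> i j; exists (i.1 ++ j.1, maxn i.2 j.2).
    by split; [move=> v; rewrite mem_cat => ->|exact: leq_maxl].
  by split; [move=> v; rewrite mem_cat => ->; rewrite orbT|exact: leq_maxr].
Defined.

Theorem theorem2p3 (R : realType) (G : groupType) (c : {posnum R})
    (mu : dual (Linfty G c)) (hmu : means mu)
    (hfin : forall F : set (discrete_group G),
      finite_set F -> mu (indic_Linfty c F) = 0)
    (x : discrete_group G) (hx : x <> 1%g) :
  exists (I : directedType) (S : I -> Cplus G c),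
    (fun i => mean_of (S i)) @ net_filter I --> mu /\
    forall i, S i `&` [set (x * s)%g | s in S i] = set0.
Proof.
have approx (i : finite_tests (Linfty G c)) : exists S : Cplus G c,
    S `&` [set (x * g)%g | g in S] = set0 /\
    forall phi, phi \in i.1 -> `|mean_of S phi - mu phi| <= i.2.+1%:R^-1.
  exact: exists_translate_free_mean.
have [S SP] := choice approx.
exists (finite_tests (Linfty G c)), S; split=> [|i]; last by have [] := SP i.
apply/dual_cvgP => phi; apply/cvgrPdist_le => e e0.
exists ([:: phi], Num.truncn e^-1) => // -[s n] /= [phis en].
have [_ /(_ phi)] := SP (s, n); rewrite distrC => /= h.
apply: (le_trans (h (phis _ (mem_head _ _)))).
rewrite -[leRHS]invrK lef_pV2 ?posrE ?invr_gt0//.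
apply: (le_trans (ltW (truncnS_gt _))).
by rewrite ler_nat.
Qed.
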